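(* Let $r\ge 2$ be an integer. (i) If $n,d\ge 1$ and $k$ are integers with $2\le k\le r$ and $n\leq k2^{\lfloor d/k\rfloor}$, then there is a $K_{r+1}$-free graph in $\mathcal{I}(n,d)$ with $t_k(n)$ edges. (ii) Moreover, for all $\epsilon>0$ there exists $\delta>0$ (depending only on $\epsilon$ and $r$) such that if $n,d\ge 1$ and $k$ are integers with $2\le k\le r$, $n\leq k2^{\lfloor d/k\rfloor}$ and $\frac{1}{n}2^{\frac{d}{k+1}}<\delta$, then the maximum number of edges in a $K_{r+1}$-free graph in $\mathcal{I}(n,d)$ is at most $\left(1-\frac{1}{k}+\epsilon\right)\binom{n}{2}$.
   Context: A subcube of $\{0,1\}^d$ is a (non-empty) set of points of $\{0,1\}^d$ obtained by fixing the values of some set of coordinates (possibly none, possibly all) and letting the remaining coordinates vary freely. Given a finite family (multiset) of subcubes of $\{0,1\}^d$, in which the same subcube may occur several times, its intersection graph has one vertex for each member of the family, two distinct vertices being adjacent if and only if the corresponding subcubes have non-empty intersection (so two copies of the same subcube are adjacent). $\mathcal{I}(n,d)$ is the set of all graphs on $n$ vertices which can be realised as the intersection graph of a family of $n$ subcubes of $\{0,1\}^d$. $T_k(n)$ is the $k$-partite Turán graph on $n$ vertices (the complete $k$-partite graph with part sizes as equal as possible, empty parts allowed) and $t_k(n)$ is its number of edges. The parameter $r$ is regarded as fixed. *)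

(* Defs.v *)
From HB Require Import structures.
From mathcomp Require Import all_boot.

Set Implicit Arguments.
Unset Strict Implicit.
Unset Printing Implicit Defensive.

Section SimpleGraphs.
Variable n : nat.

Record sgraph := SGraph {
  edges :> {set {set 'I_n}};
  edges_card2 : [forall e in edges, #|e| == 2]
}.

HB.instance Definition _ := [isSub for edges].
HB.instance Definition _ := [Finite of sgraph by <:].

Definition adj (G : sgraph) : rel 'I_n :=
  fun x y => [set x; y] \in edges G.

Definition nb_edges (G : sgraph) : nat := #|edges G|.

Lemma edges_of_rel_card2 (e : rel 'I_n) :
  [forall A in [set [set p.1; p.2] | p : 'I_n * 'I_n & (p.1 != p.2) && e p.1 p.2],
     #|A : {set 'I_n}| == 2].
Proof.
apply/forall_inP => _ /imsetP[p + ->].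
by rewrite inE cards2 => /andP[-> _].
Qed.

(* Loops are discarded and a one-sided e is symmetrised. *)
Definition sgraph_of_rel (e : rel 'I_n) : sgraph :=
  SGraph (edges_of_rel_card2 e).

Lemma adj_sgraph_of_rel (e : rel 'I_n) x y : symmetric e ->
  adj (sgraph_of_rel e) x y = (x != y) && e x y.
Proof.
move=> e_sym; apply/imsetP/idP => [[[a b] + E]|h]; last first.
  by exists (x, y); rewrite ?inE.
rewrite inE /= => /andP[nab eab].
have := set21 x y; have := set22 x y; have := cards2 x y.
rewrite E cards2 nab !inE; case: eqP => // nxy _.
case/orP=> /eqP yE /orP[]/eqP xE; move: nxy; rewrite xE yE // => _;
  by rewrite ?eab // e_sym eab.
Qed.

Definition is_clique (G : sgraph) (A : {set 'I_n}) : bool :=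
  [forall x in A, forall y in A, (x != y) ==> adj G x y].

Definition K_free (m : nat) (G : sgraph) : bool :=
  ~~ [exists A : {set 'I_n}, (#|A| == m) && is_clique G A].

End SimpleGraphs.

(* The parts are the residue classes mod k; see card_turan_part. *)
Definition turan_graph (k n : nat) : sgraph n :=
  sgraph_of_rel (fun x y : 'I_n => x %% k != y %% k).

Definition turan_number (k n : nat) : nat := nb_edges (turan_graph k n).

Lemma card_turan_part (k n j : nat) : j < k ->
  #|[set x : 'I_n | x %% k == j]| = n %/ k + (j < n %% k).
Proof.
move=> jk; have k0 : 0 < k by apply: leq_ltn_trans jk.
rewrite -sum1dep_card big_mkcond /=.
transitivity (\sum_(x < n) (x %% k == j)).
  by apply: eq_bigr => x _; case: (_ == _).
elim: n => [|n IH]; first by rewrite big_ord0 div0n mod0n.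
rewrite big_ord_recr /= IH divnS // modnS.
have [dvd|_] := boolP (k %| n.+1); last first.
  by rewrite add0n ltnS -addnA; case: (ltngtP j (n %% k)).
have nk : (n %% k).+1 = k.
  apply/eqP; rewrite eqn_leq ltn_pmod //= dvdn_leq //.
  by rewrite /dvdn -addn1 modnDml addn1.
rewrite ltn0 addn0.
move: jk; rewrite -nk ltnS.
by rewrite nk; case: (ltngtP j (n %% k)) => // _ _; rewrite addnC ?addn0 ?add0n // addnC.
Qed.

Notation cube d := {ffun 'I_d -> bool}.

Definition subcube (d : nat) (S : {set 'I_d}) (a : cube d) : {set cube d} :=
  [set x : cube d | [forall i in S, x i == a i]].

Definition is_subcube (d : nat) (C : {set cube d}) : bool :=
  [exists S : {set 'I_d}, exists a : cube d, C == subcube S a].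

Definition intersection_graph (n d : nat) (F : {ffun 'I_n -> {set cube d}}) :
    sgraph n :=
  sgraph_of_rel (fun x y => F x :&: F y != set0).

Definition subcube_graphs (n d : nat) : {set sgraph n} :=
  [set G | [exists F : {ffun 'I_n -> {set cube d}},
     [forall x, is_subcube (F x)] && (G == intersection_graph F)]].

(* The value is 0 when no graph qualifies. *)
Definition max_edges (m n d : nat) : nat :=
  \max_(G in subcube_graphs n d | K_free m G) nb_edges G.

(* Main.v *)
Require Import Defs.
From mathcomp Require Import all_boot all_order all_algebra.
From mathcomp Require Import ring lra zify.
From mathcomp Require Import reals exp.

Import Order.TTheory GRing.Theory Num.Theory.
Local Open Scope ring_scope.

(** Part (i) is realised by the Turan graph itself. Cut the coordinates into k
    blocks of length d %/ k; the vertex x fixes the block number x %% k to the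
    binary digits of x %/ k and leaves the other coordinates free. Subcubes
    that fix different blocks meet, and distinct subcubes that fix the same
    block are disjoint ([intersection_graph_turan_cubes]).

    Part (ii) compares two estimates of the number N of (k+1)-cliques.
    - Subcubes have the Helly property ([subcube_helly]), so every clique of
      the intersection graph has a common point. In a K_{r+1}-free graph each
      of the 2^d points lies in at most r members of the family, whence
      N <= 2^d 'C(r, k+1) ([card_cliques_intersection_graph]).
    - By the Moon-Moser inequality ([moon_moser]), a graph on n vertices with
      at least p n^2 / 2 edges satisfies
      (s+1) N_{s+1} >= (1 - s (1 - p)) n N_s for s >= 1, where N_s counts the
      s-cliques ([clique_ratio]). So if p exceeds 1 - 1/k by a constant,
      then N is at least a constant times n^(k+1) ([clique_supersaturation]).

    If the edge bound failed, both estimates together would bound n by a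
    constant times 2^(d/(k+1)), which contradicts 2^(d/(k+1)) < delta n for a
    small delta; the choice
    delta = eps / (2 (1 + eps) r) works for every k at once. *)

(** * Clique counts and the Moon-Moser inequality *)

Section Cliques.
Set Implicit Arguments.
Unset Strict Implicit.
Local Open Scope nat_scope.
Variables (T : finType) (e : rel T).
Hypothesis e_sym : symmetric e.
Hypothesis e_irr : irreflexive e.

(** Cliques of a relation on a finite type; for the adjacency relation of an
    [sgraph] this unfolds to [is_clique]. *)
Definition clique (A : {set T}) : bool :=
  [forall x in A, forall y in A, (x != y) ==> e x y].

(** The cliques with s elements. *)
Definition cliques (s : nat) : {set {set T}} :=
  [set A : {set T} | (#|A| == s) && clique A].

(** The vertices related to every element of B. *)
Definition common_nbrs (B : {set T}) : {set T} :=
  [set v | [forall x in B, e v x]].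

Lemma cliqueP (A : {set T}) :
  reflect {in A &, forall x y, x != y -> e x y} (clique A).
Proof.
apply: (iffP forall_inP) => [h x y xA yA nxy | h x xA].
  by have /forall_inP/(_ y yA)/implyP := h x xA; exact.
by apply/forall_inP => y yA; apply/implyP; exact: h.
Qed.

Lemma common_nbrsP (B : {set T}) (v : T) :
  reflect {in B, forall x, e v x} (v \in common_nbrs B).
Proof. by rewrite inE; apply: forall_inP. Qed.

Lemma common_nbrs_notin (B : {set T}) (v : T) :
  v \in common_nbrs B -> v \notin B.
Proof.
by move=> /common_nbrsP vB; apply/negP => /vB; rewrite e_irr.
Qed.

Lemma clique_setU1 (B : {set T}) (v : T) :
  v \notin B -> clique (v |: B) = clique B && (v \in common_nbrs B).
Proof.
move=> vB; apply/cliqueP/andP => [h|[/cliqueP clB /common_nbrsP nB] x y].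
  split; first by apply/cliqueP => x y xB yB; apply: h; rewrite setU1r.
  apply/common_nbrsP => x xB; apply: h; rewrite ?setU11 ?setU1r //.
  by apply: contraNneq vB => ->.
rewrite !in_setU1 => /orP[/eqP->|xB] /orP[/eqP->|yB] nxy.
- by rewrite eqxx in nxy.
- exact: nB.
- by rewrite e_sym nB.
- exact: clB.
Qed.

(** Removing a vertex is a bijection from the pairs (A, v) with A an
    (s+1)-clique and v in A to the pairs (B, v) with B an s-clique and v a
    common neighbour of B; both double counts below are instances. *)
Lemma sum_cliques_setD1 (F : {set T} -> T -> nat) (s : nat) :
  \sum_(A in cliques s.+1) \sum_(v in A) F (A :\ v) v =
  \sum_(B in cliques s) \sum_(v in common_nbrs B) F B v.
Proof.
rewrite !pair_big_dep /=.
rewrite (reindex_onto (fun p : {set T} * T => (p.2 |: p.1, p.2))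
                      (fun p => (p.1 :\ p.2, p.2))) /=; last first.
  by case=> A v /= /andP[_ vA]; rewrite setD1K.
have E (B : {set T}) v :
    [&& v |: B \in cliques s.+1, v \in v |: B & ((v |: B) :\ v, v) == (B, v)]
    = (B \in cliques s) && (v \in common_nbrs B).
  rewrite setU11 xpair_eqE eqxx andbT /= ![_ \in cliques _]inE.
  case: (boolP (v \in B)) => vB.
    have /negbTE-> : v \notin common_nbrs B.
      by apply: contraL vB; exact: common_nbrs_notin.
    rewrite andbF; apply/negbTE; rewrite negb_and; apply/orP; right.
    by apply: contraTneq vB => <-; rewrite !inE eqxx.
  by rewrite setU1K // eqxx andbT cardsU1 vB clique_setU1 // eqSS andbA.
apply: eq_big => [[B v]|[B v]] /=; first by rewrite -andbA E.
rewrite -andbA E => /andP[_ /common_nbrs_notin vB].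
by rewrite setU1K.
Qed.

Lemma sum_card_common_nbrs (s : nat) :
  \sum_(B in cliques s) #|common_nbrs B| = s.+1 * #|cliques s.+1|.
Proof.
transitivity (\sum_(B in cliques s) \sum_(v in common_nbrs B) 1).
  by apply: eq_bigr => B _; rewrite sum1_card.
rewrite -(sum_cliques_setD1 (fun _ _ => 1)) mulnC -sum_nat_const.
by apply: eq_bigr => A; rewrite inE sum1_card => /andP[/eqP].
Qed.

(** If w misses some x in A, then x is the only vertex whose removal can make
    w a common neighbour of the rest. *)
Lemma card_setD1_common_nbrs (s : nat) (A : {set T}) (w : T) :
  #|A| = s.+1 ->
  #|[set v in A | w \in common_nbrs (A :\ v)]| <=
    1 + s * (w \in common_nbrs A).
Proof.
move=> cA; case: (boolP (w \in common_nbrs A)) => wA.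
  rewrite muln1 add1n -cA; apply/subset_leq_card/subsetP => v.
  by rewrite inE => /andP[].
rewrite muln0 addn0.
have [x xA nwx] : exists2 x, x \in A & ~~ e w x.
  move: wA; rewrite inE negb_forall => /existsP[x].
  by rewrite negb_imply => /andP[xA nwx]; exists x.
rewrite -(cards1 x); apply/subset_leq_card/subsetP => v.
rewrite inE => /andP[vA /common_nbrsP nv]; rewrite inE.
apply: contraR nwx => nvx; apply: nv.
by rewrite !inE xA andbT eq_sym.
Qed.

Lemma sum_sqr_common_nbrs (s : nat) :
  \sum_(B in cliques s) #|common_nbrs B| ^ 2 <=
    #|T| * #|cliques s.+1| + s * (s.+2 * #|cliques s.+2|).
Proof.
have -> : \sum_(B in cliques s) #|common_nbrs B| ^ 2 =
    \sum_(A in cliques s.+1) \sum_(v in A) #|common_nbrs (A :\ v)|.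
  rewrite (sum_cliques_setD1 (fun B _ => #|common_nbrs B|)).
  by apply: eq_bigr => B _; rewrite sum_nat_const mulnn.
rewrite -sum_card_common_nbrs big_distrr /= mulnC -sum_nat_const -big_split /=.
apply: leq_sum => A; rewrite inE => /andP[/eqP cA _].
(* Exchange the sums: for each w, count the v in A whose removal makes w a
   common neighbour. *)
have -> : \sum_(v in A) #|common_nbrs (A :\ v)| =
    \sum_(w : T) #|[set v in A | w \in common_nbrs (A :\ v)]|.
  transitivity (\sum_(v in A) \sum_(w : T) (w \in common_nbrs (A :\ v))).
    by apply: eq_bigr => v _; rewrite -sum1_card big_mkcond.
  rewrite exchange_big; apply: eq_bigr => w _ /=.
  rewrite -sum1_card -big_mkcondr; apply: eq_bigl => v.
  by rewrite inE.
apply: (@leq_trans (\sum_(w : T) (1 + s * (w \in common_nbrs A)))).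
  by apply: leq_sum => w _; exact: card_setD1_common_nbrs.
rewrite big_split /= sum1_card -big_distrr /= -[#|common_nbrs A|]sum1_card.
by rewrite [X in _ <= _ + s * X]big_mkcond.
Qed.

(** The Cauchy-Schwarz inequality against the constant 1. *)
Lemma sum_sqr_le (I : finType) (P : {set I}) (d : I -> nat) :
  (\sum_(i in P) d i) ^ 2 <= #|P| * \sum_(i in P) d i ^ 2.
Proof.
rewrite -(@leq_pmul2l 2) //.
have -> : 2 * (\sum_(i in P) d i) ^ 2 =
    \sum_(i in P) \sum_(j in P) 2 * (d i * d j).
  rewrite -mulnn big_distrl /= big_distrr /=; apply: eq_bigr => i _.
  by rewrite !big_distrr.
have -> : 2 * (#|P| * \sum_(i in P) d i ^ 2) =
    \sum_(i in P) \sum_(j in P) (d i ^ 2 + d j ^ 2).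
  have -> : \sum_(i in P) \sum_(j in P) (d i ^ 2 + d j ^ 2) =
      \sum_(i in P) (#|P| * d i ^ 2 + \sum_(j in P) d j ^ 2).
    by apply: eq_bigr => i _; rewrite big_split sum_nat_const.
  by rewrite big_split sum_nat_const -big_distrr /= mul2n addnn.
by apply: leq_sum => i _; apply: leq_sum => j _; exact: nat_Cauchy.
Qed.

(** The Moon-Moser inequality, with index shifted by one: if N_s is the number
    of s-cliques, then
    (s+1)^2 N_{s+1}^2 <= N_s (|T| N_{s+1} + s (s+2) N_{s+2}). *)
Lemma moon_moser (s : nat) :
  (s.+1 * #|cliques s.+1|) ^ 2 <=
    #|cliques s| * (#|T| * #|cliques s.+1| + s * (s.+2 * #|cliques s.+2|)).
Proof.
rewrite -sum_card_common_nbrs; apply: leq_trans (sum_sqr_le _ _) _.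
by rewrite leq_mul2l sum_sqr_common_nbrs orbT.
Qed.

Lemma card_cliques1 : #|cliques 1| = #|T|.
Proof.
rewrite -(card_imset predT (@set1_inj T)); apply: eq_card => A.
rewrite inE; apply/andP/imsetP => [[/cards1P[x ->] _]|[x _ ->]].
  by exists x.
rewrite cards1; split=> //; apply/cliqueP => y z.
by rewrite !inE => /eqP-> /eqP->; rewrite eqxx.
Qed.

Lemma cliques_empty (s : nat) : #|cliques s| = 0 -> #|cliques s.+1| = 0.
Proof.
move=> c0; have := sum_card_common_nbrs s.
rewrite (eq_bigl pred0); last by move=> A; rewrite (cards0_eq c0) inE.
by rewrite big_pred0_eq => /esym/eqP; rewrite muln_eq0 => /eqP.
Qed.

Section Density.
Local Open Scope ring_scope.
Variables (R : realFieldType) (p : R).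
Hypothesis edge_density : p * #|T|%:R ^+ 2 <= 2 * #|cliques 2|%:R.

(** Iterating the Moon-Moser inequality: the normalised ratio
    rho_s = (s+1) N_{s+1} / (n N_s) satisfies s rho_{s+1} >= (s+1) rho_s - 1,
    hence 1 - rho_s <= s (1 - rho_1) <= s (1 - p). Stated without division, so
    that vanishing clique counts are harmless. *)
Lemma clique_ratio (s : nat) :
  (1 - s.+1%:R * (1 - p)) * #|T|%:R * #|cliques s.+1|%:R <=
    s.+2%:R * #|cliques s.+2|%:R :> R.
Proof.
elim: s => [|s IH].
  by rewrite card_cliques1; move: edge_density; rewrite expr2; lra.
have [c0|c_gt0] := posnP #|cliques s.+1|.
  by rewrite (cliques_empty (cliques_empty c0)) (cliques_empty c0) !mulr0.
have := moon_moser s.+1.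
rewrite -(ler_nat R) !(natrM, natrX, natrD).
set a : R := #|cliques s.+1|%:R; set b : R := #|cliques s.+2|%:R.
set c : R := #|cliques s.+3|%:R; set n : R := #|T|%:R.
rewrite -/a -/b -/c -/n in IH *.
rewrite -[s.+3%:R]natr1 -[s.+2%:R]natr1 in IH *.
set q : R := s.+1%:R in IH *.
have q0 : 0 < q by rewrite ltr0n.
have a0 : 0 < a by rewrite ltr0n.
have b0 : 0 <= b by rewrite ler0n.
move=> MM.
(* With q = s.+1, multiply the goal by q * a; the Moon-Moser inequality bounds
   its right-hand side from below, and IH times (q + 1) * b closes the gap. *)
have h1 := ler_wpM2l b0 IH.
rewrite -(@ler_pM2l _ (q * a)) ?mulr_gt0 //.
have h2 := @ler_wpM2l _ (q + 1) _ _ _ h1.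
have {}h2 := h2 (addr_ge0 (ltW q0) ler01).
nra.
Qed.

(** Multiplying the ratios: a graph whose edge density p satisfies
    1 - k (1 - p) >= eta contains at least
    eta^k n^(k+1) / (k+1)! cliques on k+1 vertices, where n = |T|. *)
Lemma clique_supersaturation (k : nat) (eta : R) :
  0 <= eta -> 0 <= 1 - p -> eta <= 1 - k%:R * (1 - p) ->
  eta ^+ k * #|T|%:R ^+ k.+1 <= (k.+1)`!%:R * #|cliques k.+1|%:R.
Proof.
move=> eta0 p1; elim: k => [_|k IH hk].
  by rewrite card_cliques1 expr0 expr1 factS fact0 muln1 !mul1r.
have {}IH : eta ^+ k * #|T|%:R ^+ k.+1 <= (k.+1)`!%:R * #|cliques k.+1|%:R.
  by apply: IH; move: hk; rewrite -natr1; lra.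
have step : eta * #|T|%:R * #|cliques k.+1|%:R <= k.+2%:R * #|cliques k.+2|%:R.
  by apply: le_trans (clique_ratio k); rewrite !ler_wpM2r ?ler0n.
apply: (@le_trans _ _ (eta * #|T|%:R * ((k.+1)`!%:R * #|cliques k.+1|%:R))).
  rewrite (_ : eta ^+ k.+1 * _ = eta * #|T|%:R * (eta ^+ k * #|T|%:R ^+ k.+1)).
    by apply: ler_wpM2l IH; rewrite mulr_ge0 ?ler0n.
  by rewrite !exprS; ring.
by rewrite mulrCA (factS k.+1) mulnC natrM -[leRHS]mulrA ler_wpM2l ?ler0n.
Qed.

End Density.
End Cliques.

(** * The Turan graph as an intersection graph of subcubes *)

Section TuranConstruction.
Set Implicit Arguments.
Unset Strict Implicit.
Local Open Scope nat_scope.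

Lemma eq_from_bits (m a b : nat) :
  a < 2 ^ m -> b < 2 ^ m ->
  (forall i, i < m -> odd (a %/ 2 ^ i) = odd (b %/ 2 ^ i)) -> a = b.
Proof.
elim: m a b => [|m IH] a b; first by rewrite !ltnS !leqn0 => /eqP-> /eqP->.
move=> am bm h.
have half_lt c : c < 2 ^ m.+1 -> c./2 < 2 ^ m by rewrite expnS; lia.
rewrite -(odd_double_half a) -(odd_double_half b).
congr (_ + _.*2); first by move: (h 0 isT); rewrite !divn1 => ->.
apply: IH; rewrite ?half_lt // => i im.
by rewrite -!divn2 -!divnMA -!expnS; exact: h.
Qed.

Variables n d k : nat.
Hypothesis k_gt0 : 0 < k.

(** The j-th block of d %/ k consecutive coordinates. When d < k the division by
    zero gives 0, so block 0 is everything and the others are empty; blocks with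
    different numbers are disjoint in all cases. *)
Definition block (j : nat) : {set 'I_d} := [set i : 'I_d | i %/ (d %/ k) == j].
(** The binary digits of q, repeated in every block. *)
Definition bits (q : nat) : cube d :=
  [ffun i : 'I_d => odd (q %/ 2 ^ (i %% (d %/ k)))].
(** The vertex x lies in part x %% k and is the (x %/ k)-th of that part. *)
Definition turan_cubes : {ffun 'I_n -> {set cube d}} :=
  [ffun x : 'I_n => subcube (block (x %% k)) (bits (x %/ k))].

Lemma turan_cubes_meet (x y : 'I_n) :
  n <= k * 2 ^ (d %/ k) -> x != y ->
  (turan_cubes x :&: turan_cubes y != set0) = (x %% k != y %% k).
Proof.
move=> hn nxy; rewrite !ffunE; apply/set0Pn/idP => [[z]|dif]; last first.
  (* A common point: follow x on the block of x, and y elsewhere. *)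
  exists [ffun i : 'I_d => if i %/ (d %/ k) == x %% k then bits (x %/ k) i
                           else bits (y %/ k) i].
  rewrite !inE; apply/andP; split; apply/forall_inP => i; rewrite inE !ffunE.
    by move=> ->.
  by move=> /eqP->; rewrite [y %% k == _]eq_sym (negbTE dif).
rewrite !inE => /andP[/forall_inP zx /forall_inP zy]; apply/negP => /eqP same.
case/negP: nxy; apply/eqP/val_inj; rewrite /= (divn_eq x k) (divn_eq y k) same.
congr (_ * _ + _).
have quo_lt (u : 'I_n) : u %/ k < 2 ^ (d %/ k).
  by rewrite ltn_divLR // mulnC (leq_trans (ltn_ord u)).
(* Read digit i of both numbers at coordinate i of the common block. *)
apply: (@eq_from_bits (d %/ k)) => // i im.
have jk : y %% k < k by rewrite ltn_mod.
have id : y %% k * (d %/ k) + i < d.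
  by have := leq_divM d k; nia.
have m0 : 0 < d %/ k by lia.
have ib : (y %% k * (d %/ k) + i) %/ (d %/ k) = y %% k.
  by rewrite divnMDl // divn_small ?addn0.
have im' : (y %% k * (d %/ k) + i) %% (d %/ k) = i.
  by rewrite modnMDl modn_small.
have := zx (Ordinal id); have := zy (Ordinal id).
by rewrite !inE /= ib same eqxx !ffunE /= im' => /(_ isT)/eqP-> /(_ isT)/eqP.
Qed.

Lemma intersection_graph_turan_cubes :
  n <= k * 2 ^ (d %/ k) -> intersection_graph turan_cubes = turan_graph k n.
Proof.
move=> hn; apply: val_inj; apply/setP => A.
have E (p : 'I_n * 'I_n) :
    (p.1 != p.2) && (turan_cubes p.1 :&: turan_cubes p.2 != set0) =
    (p.1 != p.2) && (p.1 %% k != p.2 %% k).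
  by case: (boolP (p.1 == p.2)) => //= nxy; rewrite turan_cubes_meet.
by apply/imsetP/imsetP => -[p pP ->]; exists p => //; move: pP; rewrite !inE E.
Qed.

Lemma turan_cubes_subcube (x : 'I_n) : is_subcube (turan_cubes x).
Proof.
rewrite ffunE; apply/existsP; exists (block (x %% k)).
by apply/existsP; exists (bits (x %/ k)).
Qed.

Lemma K_free_turan_graph (r : nat) : k <= r -> K_free r.+1 (turan_graph k n).
Proof.
move=> kr; apply/existsP => -[A /andP[/eqP cA /forall_inP clA]].
suff : #|A| <= k by rewrite cA ltnNge kr.
pose part (x : 'I_n) : 'I_k := Ordinal (ltn_pmod x k_gt0).
have part_inj : {in A &, injective part}.
  move=> x y xA yA /(congr1 val) /= same; apply/eqP/negPn/negP => nxy.
  have /forall_inP/(_ y yA) := clA x xA.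
  rewrite nxy adj_sgraph_of_rel; last by move=> u v; rewrite eq_sym.
  by rewrite same eqxx andbF.
by rewrite -(card_in_imset part_inj) -[X in _ <= X]card_ord max_card.
Qed.

End TuranConstruction.

(** * Cliques in intersection graphs of subcubes *)

Section Helly.
Set Implicit Arguments.
Unset Strict Implicit.
Local Open Scope nat_scope.
Variables n d : nat.
Variable F : {ffun 'I_n -> {set cube d}}.
Hypothesis F_subcube : forall x, is_subcube (F x).

Lemma subcube_neq0 (C : {set cube d}) : is_subcube C -> C != set0.
Proof.
move=> /existsP[S /existsP[a /eqP->]]; apply/set0Pn; exists a.
by rewrite inE; apply/forall_inP.
Qed.

(** The Helly property: pairwise intersecting subcubes have a common point. *)
Lemma subcube_helly (A : {set 'I_n}) :
  {in A &, forall x y, F x :&: F y != set0} ->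
  exists z, {in A, forall x, z \in F x}.
Proof.
move=> meet.
have /all_sig2[S _ hS] x :
    {S : {set 'I_d} | true & [exists a, F x == subcube S a]}.
  have h := F_subcube x; exists (xchoose (existsP h)) => //.
  exact: xchooseP (existsP h).
have /all_sig2[a _ ha] x : {a : cube d | true & F x == subcube (S x) a}.
  exists (xchoose (existsP (hS x))) => //; exact: xchooseP (existsP (hS x)).
(* A coordinate fixed by some member of A gets the value that it prescribes; the
   members that fix it agree since they meet. The value true is arbitrary. *)
exists [ffun i => if [pick x in A | i \in S x] is Some x then a x i else true].
move=> x xA; rewrite (eqP (ha x)) inE; apply/forall_inP => i iS; rewrite ffunE.
case: pickP => [y /andP[yA iSy]|/(_ x)]; last by rewrite xA iS.
have /set0Pn[z] := meet x y xA yA.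
rewrite (eqP (ha x)) (eqP (ha y)) !inE.
by move=> /andP[/forall_inP/(_ i iS)/eqP<- /forall_inP/(_ i iSy)/eqP<-].
Qed.

Lemma adj_intersection_graph (x y : 'I_n) :
  adj (intersection_graph F) x y = (x != y) && (F x :&: F y != set0).
Proof. by rewrite adj_sgraph_of_rel // => u v; rewrite setIC. Qed.

Lemma card_cubes_at_point (r : nat) (z : cube d) :
  K_free r.+1 (intersection_graph F) -> #|[set x | z \in F x]| <= r.
Proof.
move=> free; rewrite leqNgt; apply: contra free => big.
have : 0 <
    #|[set A : {set 'I_n} | A \subset [set x | z \in F x] & #|A| == r.+1]|.
  by rewrite cards_draws bin_gt0.
case/card_gt0P => A; rewrite inE => /andP[/subsetP sA cA].
apply/existsP; exists A; rewrite cA /=.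
apply/forall_inP => x /sA; rewrite inE => zx.
apply/forall_inP => y /sA; rewrite inE => zy.
apply/implyP => nxy; rewrite adj_intersection_graph nxy /=.
by apply/set0Pn; exists z; rewrite inE zx.
Qed.

(** Each s-clique is a set of s members of the family through a common point,
    and at most r members pass through any given point. *)
Lemma card_cliques_intersection_graph (r s : nat) :
  K_free r.+1 (intersection_graph F) ->
  #|[set A : {set 'I_n} | (#|A| == s) && is_clique (intersection_graph F) A]|
    <= 2 ^ d * 'C(r, s).
Proof.
move=> free.
pose draws z :=
  [set A : {set 'I_n} | A \subset [set x | z \in F x] & #|A| == s].
apply: (@leq_trans #|\bigcup_(z : cube d) draws z|).
  apply/subset_leq_card/subsetP => A; rewrite inE => /andP[cA /forall_inP clA].
  have [x y xA yA|z hz] := @subcube_helly A.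
    have [<-|nxy] := eqVneq x y; first by rewrite setIid subcube_neq0.
    have /forall_inP/(_ y yA) := clA x xA.
    by rewrite nxy adj_intersection_graph => /andP[].
  apply/bigcupP; exists z => //; rewrite inE cA andbT.
  by apply/subsetP => x xA; rewrite inE hz.
apply: (@leq_trans (\sum_(z : cube d) #|draws z|)).
  apply: (big_ind2 (fun (X : {set {set 'I_n}}) m => #|X| <= m)) => //.
    by rewrite cards0.
  move=> X m Y l Xm Yl; apply: leq_trans (leq_card_setU _ _) _.
  exact: leq_add.
have -> : 2 ^ d = #|{: cube d}| by rewrite card_ffun card_bool card_ord.
rewrite -sum_nat_const.
apply: leq_sum => z _; rewrite cards_draws leq_bin2l //.
exact: card_cubes_at_point.
Qed.
End Helly.

(** * The upper bound on the number of edges *)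

Lemma ffact_leq_exp (m s : nat) : (m ^_ s <= m ^ s)%N.
Proof.
elim: s => [|s IH]; first by rewrite ffactn0.
by rewrite ffactnSr expnSr leq_mul // leq_subr.
Qed.

Lemma adj_sym (n : nat) (G : sgraph n) : symmetric (adj G).
Proof. by move=> x y; rewrite /adj setUC. Qed.

Lemma adj_irr (n : nat) (G : sgraph n) : irreflexive (adj G).
Proof.
move=> x; apply/negP => /(forall_inP (edges_card2 G)).
by rewrite setUid cards1.
Qed.

Lemma card_cliques2 (n : nat) (G : sgraph n) :
  #|cliques (adj G) 2| = nb_edges G.
Proof.
apply: eq_card => A; rewrite inE; apply/andP/idP.
  case=> /cards2P[x [y [nxy ->]]].
  by move=> /cliqueP; apply; rewrite ?set21 ?set22.
move=> eA; have cA := forall_inP (edges_card2 G) A eA; split=> //.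
have /cards2P[x [y [nxy A_xy]]] := cA.
have xy : adj G x y by rewrite /adj -A_xy.
apply/cliqueP => u v; rewrite A_xy !inE.
by move=> /orP[]/eqP-> /orP[]/eqP->; rewrite ?eqxx // adj_sym.
Qed.

(** The bound of part (ii) for one family, with the explicit constant
    delta = eta / r where eta = eps / (2 (1 + eps)). *)
Lemma nb_edges_intersection_graph_le (R : realType) (r n d k : nat)
    (eps : R) (F : {ffun 'I_n -> {set cube d}}) :
  (0 < r)%N -> (0 < n)%N -> (2 <= k)%N -> 0 < eps ->
  1 / n%:R * 2 `^ (d%:R / k.+1%:R) < eps / (2 * (1 + eps)) / r%:R ->
  (forall x, is_subcube (F x)) -> K_free r.+1 (intersection_graph F) ->
  (nb_edges (intersection_graph F))%:R <=
    (1 - 1 / k%:R + eps) * 'C(n, 2)%:R :> R.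
Proof.
move=> r0 n0 k2 eps0 small cubes free.
set eta := eps / (2 * (1 + eps)) in small.
set w : R := 2 `^ _ in small.
have eps1 : 0 < 1 + eps by rewrite addr_gt0.
have eta_eps : 2 * (1 + eps) * eta = eps.
  by rewrite /eta mulrC divfK // gt_eqF // mulr_gt0.
have eta0 : 0 < eta by rewrite divr_gt0 ?mulr_gt0.
have eta1 : eta <= 1 by nra.
have nR : 0 < n%:R :> R by rewrite ltr0n.
have rR : 1 <= r%:R :> R by rewrite ler1n.
have kR : 2 <= k%:R :> R by rewrite ler_nat.
have w1 : 1 <= w.
  by rewrite -(powRr0 (2 : R)) ler_powR ?ler1n ?divr_ge0.
have w_exp : w ^+ k.+1 = 2 ^+ d.
  rewrite -powR_mulrn ?powR_ge0 // -powRrM divfK ?pnatr_eq0 //.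
  by rewrite powR_mulrn.
have w_lt : r%:R * w < eta * n%:R.
  rewrite -ltr_pdivrMr // (_ : _ / _ = 1 / n%:R * w * r%:R); last by ring.
  by rewrite -ltr_pdivlMr //; lra.
(* Since w >= 1, smallness of w / n forces n to be large, so that 'C(n, 2) is
   close to n^2 / 2. *)
have n_large : 1 <= eta * n%:R by nra.
rewrite leNgt; apply/negP => many.
(* The edge density for which 1 - k (1 - p) is exactly eta. *)
pose p : R := 1 - (1 - eta) / k%:R.
have binE : 'C(n, 2)%:R * 2 = n%:R * (n%:R - 1) :> R.
  rewrite -natrM -[2%N]/(2`!) bin_ffact.
  rewrite ffactnS ffactn1 natrM; congr (_ * _).
  by rewrite -subn1 natrB.
have density :
    p * #|'I_n|%:R ^+ 2 <= 2 * #|cliques (adj (intersection_graph F)) 2|%:R.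
  rewrite card_cliques2 card_ord /p.
  set i : R := k%:R^-1; rewrite div1r -/i in many *.
  have i0 : 0 < i by rewrite invr_gt0; lra.
  have i2 : i <= 1 / 2 by rewrite div1r lef_pV2 ?posrE //; lra.
  set N : R := n%:R in nR n_large binE *.
  set e : R := (nb_edges _)%:R in many *.
  have {}many : (1 - i + eps) * (N * (N - 1)) < 2 * e by rewrite -binE; lra.
  have : (1 + eps) * 2 <= eps * N by rewrite -eta_eps; nra.
  have : eta * i <= eps / 2 by nra.
  move=> h1 h2.
  have h3 : 1 - i + eps <= (eps - eta * i) * N by nra.
  have {}h3 := ler_wpM2r (ltW nR) h3.
  by rewrite expr2; nra.
have := clique_supersaturation (@adj_sym _ _) (@adj_irr _ _) density
  (k := k) (eta := eta).
have pE : 1 - p = (1 - eta) / k%:R by rewrite /p; ring.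
rewrite pE mulrCA divff ?gt_eqF ?mulr1; try lra.
rewrite (ltW eta0) divr_ge0 ?subr_ge0 // => /(_ isT isT).
rewrite subKr lexx card_ord => /(_ isT).
apply/negP; rewrite -ltNge.
(* On the other side, N_{k+1} (k+1)! <= 2^d r^(k+1) < (eta n)^(k+1), where
   (eta n)^(k+1) <= eta^k n^(k+1) because eta <= 1. *)
have cl :
    (k.+1`! * #|cliques (adj (intersection_graph F)) k.+1| <= 2 ^ d * r ^ k.+1)%N.
  have h := card_cliques_intersection_graph cubes k.+1 free.
  apply: leq_trans (leq_mul (leqnn _) h) _.
  by rewrite mulnCA leq_mul2l mulnC bin_ffact ffact_leq_exp orbT.
rewrite -natrM; apply: le_lt_trans (_ : (2 ^ d * r ^ k.+1)%:R < _).
  by rewrite ler_nat.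
rewrite natrM !natrX -w_exp -exprMn mulrC.
apply: (@lt_le_trans _ _ ((eta * n%:R) ^+ k.+1)).
  by rewrite ltr_pXn2r // nnegrE; nra.
by rewrite exprMn ler_wpM2r ?exprn_ge0 // exprS ler_piMl ?exprn_ge0 ?(ltW eta0).
Qed.

Theorem theorem6 (R : realType) (r : nat) (hr : (2 <= r)%N) :
  (forall n d k : nat, (1 <= n)%N -> (1 <= d)%N -> (2 <= k <= r)%N ->
     (n <= k * 2 ^ (d %/ k))%N ->
     exists G : sgraph n,
       [/\ G \in subcube_graphs n d, K_free r.+1 G
         & nb_edges G = turan_number k n])
  /\
  (forall eps : R, 0 < eps ->
     exists delta : R, 0 < delta /\
       forall n d k : nat, (1 <= n)%N -> (1 <= d)%N -> (2 <= k <= r)%N ->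
         (n <= k * 2 ^ (d %/ k))%N ->
         1 / n%:R * 2 `^ (d%:R / k.+1%:R) < delta ->
         (max_edges r.+1 n d)%:R <= (1 - 1 / k%:R + eps) * 'C(n, 2)%:R).
Proof.
split=> [n d k _ _ /andP[k2 kr] hn|eps eps0].
  have k0 : (0 < k)%N by apply: leq_trans k2.
  exists (turan_graph k n); split; rewrite ?K_free_turan_graph //.
  rewrite inE; apply/existsP; exists (turan_cubes n d k).
  rewrite intersection_graph_turan_cubes // eqxx andbT.
  by apply/forallP => x; exact: turan_cubes_subcube.
have r0 : (0 < r)%N by apply: leq_trans hr.
exists (eps / (2 * (1 + eps)) / r%:R); split.
  by rewrite !divr_gt0 ?ltr0n // mulr_gt0 // addr_gt0.
move=> n d k n0 _ /andP[k2 _] _ small.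
have kR : 2 <= k%:R :> R by rewrite ler_nat.
apply: (big_ind (fun m => m%:R <= (1 - 1 / k%:R + eps) * 'C(n, 2)%:R)).
- rewrite mulr_ge0 //; have : 1 / k%:R <= 1 :> R by rewrite ler_pdivrMr; lra.
  by lra.
- by move=> a b ha hb; rewrite /maxn; case: ifP.
move=> G /andP[]; rewrite inE => /existsP[F /andP[/forallP cubes /eqP->]] free.
exact: nb_edges_intersection_graph_le small cubes free.
Qed.
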